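(* Let $m,n,m',n'\ge 3$ and $l,l'\ge -1$ be integers. If the complete dumbbell graphs $\overline{D}(m,l,n)$ and $\overline{D}(m',l',n')$ are non-isomorphic, then $X_{\overline{D}(m,l,n)}\ne X_{\overline{D}(m',l',n')}$.
   Context: All graphs are finite and simple; $P_l$ and $K_n$ denote the path and the complete graph on the indicated number of vertices. For $m,n\ge 3$ and $l\ge 2$, the complete dumbbell graph $\overline{D}(m,l,n)$ consists of disjoint $K_m$, $K_n$ and $P_l$, with one leaf of $P_l$ connected by an edge to one vertex of $K_m$ and the other leaf connected by an edge to one vertex of $K_n$. For $l=1$, the single vertex of $P_1$ is adjacent to one vertex of $K_m$ and to one vertex of $K_n$. For $l=0$, it is $K_m$ and $K_n$ (disjoint) connected by an edge. For $l=-1$, it is $K_m$ and $K_n$ sharing exactly one vertex. In all cases it has $m+l+n$ vertices. The chromatic symmetric function of a graph $G$ with vertices $v_1,\ldots,v_d$ is $X_G=\sum_{\kappa} x_{\kappa(v_1)}\cdots x_{\kappa(v_d)}$, the sum over all proper colourings $\kappa:V(G)\to\mathbb{N}$, with $x_1,x_2,\ldots$ commuting variables. *)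

(* Defs.v *)
From HB Require Import structures.
From mathcomp Require Import all_boot all_order all_algebra.
From mathcomp Require Import finmap.
From mathcomp.multinomials Require Import monalg.

Set Implicit Arguments.
Unset Strict Implicit.
Unset Printing Implicit Defensive.

Import Order.TTheory GRing.Theory Num.Theory.
Local Open Scope ring_scope.

Record sgraph := SGraph {
  vertex :> finType;
  adj : rel vertex;
  adj_sym : symmetric adj;
  adj_irrefl : irreflexive adj
}.

Definition isomorphic (G H : sgraph) : Prop :=
  exists f : G -> H, bijective f /\ forall u v, adj (f u) (f v) = adj u v.

Definition proper_colouring (G : sgraph) (C : eqType) (k : G -> C) : bool :=
  [forall u, forall v, adj u v ==> (k u != k v)].

(* A formal power series with integer coefficients in commuting variables
   x_0, x_1, x_2, ... : it sends a monomial to the coefficient it carries. *)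
Definition pseries := {cmonom nat} -> int.

Definition colour_monomial (G : sgraph) (k : G -> nat) : {cmonom nat} :=
  \big[mmul/mone]_(v : G) ucm (k v).

Lemma colour_monomial_supp (G : sgraph) (k : G -> nat) (v : G) :
  k v \in finsupp (colour_monomial k).
Proof.
by rewrite /colour_monomial (bigD1 v) //= mdomD mdomU in_fsetU in_fset1 eqxx.
Qed.

(* The coefficient of a is the number of proper colourings k with
   prod_v x_(k v) = a.  By colour_monomial_supp every such k takes its values
   in the finite support of a, so ranging over {ffun G -> finsupp a} misses no
   colouring by natural numbers. *)
Definition chromatic_symmetric_function (G : sgraph) : pseries := fun a =>
  #|[set k : {ffun G -> finsupp a} | proper_colouring k &
       colour_monomial (fun v => val (k v)) == a]|%:Z.

Section Dumbbell.
Variables (m : nat) (l : int) (n : nat).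

(* The vertices 0, 1, ..., m + l + n - 1 are laid out in a row: the first m
   form K_m, the last n (those from m + l on) form K_n, and each vertex is
   joined to the next one.  For l >= 0 the vertices m, ..., m + l - 1 form P_l,
   attached to the vertex m - 1 of K_m and to the vertex m + l of K_n (for
   l = 0 these two are adjacent); for l = -1 the vertex m - 1 is the one
   shared by K_m and K_n.  The absolute value is inert when -1 <= l and
   0 < m, n. *)
Definition dumbbell_vertex := 'I_(absz (m%:Z + l + n%:Z)).

Definition dumbbell_adj : rel dumbbell_vertex := fun i j =>
  (i != j) &&
  [|| (i < m)%N && (j < m)%N,
      (m%:Z + l <= i%:Z) && (m%:Z + l <= j%:Z),
      j == i.+1 :> nat
    | i == j.+1 :> nat].

Lemma dumbbell_sym : symmetric dumbbell_adj.
Proof.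
move=> i j; rewrite /dumbbell_adj eq_sym andbC [in RHS]andbC.
congr (_ && _); rewrite [(i < m)%N && _]andbC [(_ <= i%:Z) && _]andbC.
by congr [|| _, _ | _]; rewrite orbC.
Qed.

Lemma dumbbell_irrefl : irreflexive dumbbell_adj.
Proof. by move=> i; rewrite /dumbbell_adj eqxx. Qed.

Definition complete_dumbbell : sgraph := SGraph dumbbell_sym dumbbell_irrefl.

End Dumbbell.

(* Main.v *)
Require Import Defs.
From mathcomp Require Import all_boot all_order all_algebra.
From mathcomp Require Import finmap zify.
From mathcomp.multinomials Require Import monalg.

Set Implicit Arguments.
Unset Strict Implicit.
Unset Printing Implicit Defensive.

Import Order.TTheory GRing.Theory Num.Theory.

(** The chromatic polynomial already tells complete dumbbell graphs apart, and
it is a specialisation of the chromatic symmetric function: setting q of the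
variables to 1 and the others to 0 amounts to adding up the coefficients of the
monomials in those q variables ([chromatic_count_sum]).

Colour the vertices of the dumbbell graph from left to right.  The neighbours
that precede a vertex always form a clique, hence carry distinct colours, so a
vertex with d earlier neighbours can be coloured in q - d ways whatever choices
were made before ([chromatic_count_elimination]).  This writes the chromatic
polynomial as a product of linear factors: K_m contributes the roots
0, ..., m - 1, the l + 1 vertices that follow contribute the root 1, and the rest
of K_n contributes the roots 1, ..., n - 1 ([chromatic_count_dumbbell]); in other
words it is x(x-1)...(x-m+1) * (x-1)^(l+1) * (x-1)...(x-n+1).

A polynomial determines the multiset of its roots ([perm_eq_roots]).  A root
k >= 2 has multiplicity [k < m] + [k < n]; as m and n are at least 3, these
multiplicities determine the unordered pair {m, n}, and the degree then
determines l ([dumbbell_parameters]).  Finally, exchanging m and n only reverses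
the row of vertices ([isomorphic_flip]). *)

Definition chromatic_count (G : sgraph) (q : nat) : nat :=
  #|[set k : {ffun G -> 'I_q} | proper_colouring k]|.

Lemma colour_monomial_lt (G : sgraph) (q : nat) (k : {ffun G -> 'I_q}) x :
  x \in finsupp (colour_monomial (fun v => val (k v))) -> x < q.
Proof.
rewrite /colour_monomial.
apply: (big_ind (fun a : {cmonom nat} => x \in finsupp a -> x < q))
  => [|a b IHa IHb|v _].
- by rewrite mdom1 in_fset0.
- by rewrite mdomD in_fsetU => /orP[/IHa|/IHb].
- by rewrite mdomU in_fset1 => /eqP ->; apply: ltn_ord.
Qed.

(** The support of a in the definition of the coefficient can be replaced by any
larger palette {0, ..., q - 1}: a colouring with monomial a uses exactly the
colours in the support.  The palette no longer depends on a, so that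
coefficients can be added up. *)
Lemma coefficient_count (G : sgraph) (q : nat) (a : {cmonom nat}) :
  (forall x, x \in finsupp a -> x < q) ->
  chromatic_symmetric_function G a =
  #|[set k : {ffun G -> 'I_q} | proper_colouring k &
       colour_monomial (fun v => val (k v)) == a]|%:Z%R.
Proof.
move=> aq; rewrite /chromatic_symmetric_function; congr Posz.
pose f (k : {ffun G -> finsupp a}) : {ffun G -> 'I_q} :=
  [ffun v => Ordinal (aq _ (valP (k v)))].
have f_val k : (fun v => val (f k v)) =1 (fun v => val (k v)).
  by move=> v; rewrite ffunE.
have f_inj : injective f.
  by move=> k k' /ffunP E; apply/ffunP=> v; apply: val_inj; rewrite -!f_val E.
have monE k : colour_monomial (fun v => val (f k v)) =
    colour_monomial (fun v => val (k v)).
  by apply: eq_bigr => v _; rewrite ffunE.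
have propE k : proper_colouring (f k) = proper_colouring k.
  by apply: eq_forallb => u; apply: eq_forallb => v; rewrite !ffunE -!val_eqE.
rewrite -(card_imset _ f_inj); apply: eq_card => k; rewrite inE.
apply/imsetP/andP => [[k' + ->]|[kP /eqP ka]].
  by rewrite inE monE propE => /andP.
have ka' v : val (k v) \in finsupp a by rewrite -ka colour_monomial_supp.
have kE : k = f [ffun v => [` ka' v]%fset].
  by apply/ffunP=> v; apply: val_inj; rewrite f_val ffunE.
by exists [ffun v => [` ka' v]%fset] => //; rewrite inE -monE -propE -kE kP ka /=.
Qed.

(** Every q-colouring is counted by the coefficient of its own monomial.  The
list A may also contain monomials realised by no colouring of G, so that one
list can serve for two graphs. *)
Lemma chromatic_count_sum (G : sgraph) (q : nat) (A : seq {cmonom nat}) :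
  uniq A ->
  (forall k : {ffun G -> 'I_q}, colour_monomial (fun v => val (k v)) \in A) ->
  (forall a, a \in A -> forall x, x \in finsupp a -> x < q) ->
  (chromatic_count G q)%:Z%R = (\sum_(a <- A) chromatic_symmetric_function G a)%R.
Proof.
move=> uA kA Aq; rewrite big_seq.
under eq_bigr => a aA do rewrite (coefficient_count G (Aq a aA)).
rewrite -big_seq -(big_morph Posz PoszD (erefl _)); congr Posz.
rewrite /chromatic_count -sum1_card.
under [RHS]eq_bigr => a _.
  rewrite -sum1_card; under eq_bigl => k do rewrite inE.
  rewrite big_mkcondr; over.
rewrite exchange_big /=; apply: eq_big => [k|k _]; first by rewrite inE.
by rewrite -big_mkcond sum1_count (eq_count (eq_sym _)) count_uniq_mem ?kA.
Qed.

Lemma chromatic_count_determined (G H : sgraph) (q : nat) :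
  chromatic_symmetric_function G = chromatic_symmetric_function H ->
  chromatic_count G q = chromatic_count H q.
Proof.
move=> XE.
pose mon (K : sgraph) (k : {ffun K -> 'I_q}) :=
  colour_monomial (fun v => val (k v)).
pose A := undup (codom (@mon G) ++ codom (@mon H)).
have uA : uniq A by apply: undup_uniq.
have Aq a : a \in A -> forall x, x \in finsupp a -> x < q.
  by rewrite mem_undup mem_cat => /orP[] /codomP[k ->] x; apply: colour_monomial_lt.
have GA (k : {ffun G -> 'I_q}) : mon G k \in A.
  by rewrite mem_undup mem_cat codom_f.
have HA (k : {ffun H -> 'I_q}) : mon H k \in A.
  by rewrite mem_undup mem_cat codom_f orbT.
have := chromatic_count_sum uA GA Aq.
by rewrite XE -(chromatic_count_sum uA HA Aq) => -[].
Qed.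

Section EliminationOrder.

Variable e : rel nat.
Hypotheses (e_sym : symmetric e) (e_irr : irreflexive e).

Lemma initial_sym N : symmetric (fun u v : 'I_N => e u v).
Proof. by move=> u v; apply: e_sym. Qed.

Lemma initial_irrefl N : irreflexive (fun u : 'I_N => e u).
Proof. by move=> u; apply: e_irr. Qed.

Definition initial_graph N : sgraph :=
  SGraph (@initial_sym N) (@initial_irrefl N).

Definition extend_colouring N q (p : {ffun 'I_N -> 'I_q} * 'I_q) :
    {ffun 'I_N.+1 -> 'I_q} :=
  [ffun i => if unlift ord_max i is Some j then p.1 j else p.2].

Lemma extend_colouring_bij N q : bijective (@extend_colouring N q).
Proof.
exists (fun k : {ffun 'I_N.+1 -> 'I_q} =>
  ([ffun j : 'I_N => k (lift ord_max j)] : {ffun 'I_N -> 'I_q}, k ord_max))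
  => [[k c]|k].
  congr pair; last by rewrite ffunE unlift_none.
  by apply/ffunP=> j; rewrite !ffunE liftK.
by apply/ffunP=> i; rewrite ffunE; case: unliftP => [j|] ->; rewrite ?ffunE.
Qed.

Lemma proper_extend N q (k : {ffun 'I_N -> 'I_q}) (c : 'I_q) :
  proper_colouring (G := initial_graph N.+1) (extend_colouring (k, c)) =
  proper_colouring (G := initial_graph N) k &&
  (c \notin k @: [set j : 'I_N | e N j]).
Proof.
apply/forallP/andP => [H|[/forallP H cN] u].
  have {}H (u v : 'I_N.+1) :
      e u v -> extend_colouring (k, c) u != extend_colouring (k, c) v.
    by have /forallP/(_ v)/implyP := H u.
  split.
    apply/forallP=> u; apply/forallP=> v; apply/implyP=> uv.
    have := H (lift ord_max u) (lift ord_max v).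
    by rewrite !lift_max !ffunE !liftK; apply.
  apply/imsetP=> -[j]; rewrite inE => Nj cE.
  have := H ord_max (lift ord_max j).
  by rewrite lift_max !ffunE liftK unlift_none /= => /(_ Nj); rewrite cE eqxx.
have {}H (u' v' : 'I_N) : e u' v' -> k u' != k v'.
  by have /forallP/(_ v')/implyP := H u'.
apply/forallP=> v; apply/implyP; rewrite /= !ffunE.
case: unliftP => [i|] ->; case: unliftP => [j|] ->; rewrite ?lift_max /=.
- exact: H.
- rewrite e_sym => Ni; apply: contraNneq cN => <-.
  by apply: imset_f; rewrite inE.
- move=> Nj; apply: contraNneq cN => ->.
  by apply: imset_f; rewrite inE.
- by rewrite e_irr.
Qed.

(** The hypothesis says that the earlier neighbours of each vertex form a clique
(the natural order is a reversed perfect elimination order).  A proper colouring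
of the preceding vertices is then injective on them, so it forbids exactly as
many colours to the new vertex as there are earlier neighbours. *)
Lemma chromatic_count_elimination q N :
  (forall i j k, i < N -> j < k -> k < i -> e i j -> e i k -> e j k) ->
  chromatic_count (initial_graph N) q =
  \prod_(i < N) (q - count (e i) (iota 0 i)).
Proof.
elim: N => [|N IH] cl.
  rewrite big_ord0 -[RHS](_ : #|{ffun 'I_0 -> 'I_q}| = _).
    by apply: eq_card => k; rewrite !inE; apply/forallP=> -[].
  by rewrite card_ffun !card_ord.
rewrite big_ord_recr /= -IH; last by move=> i j k /ltnW; apply: cl.
rewrite /chromatic_count -(on_card_preimset (onW_bij _ (extend_colouring_bij N q))).
set B := [set j : 'I_N | e N j].
have cardB : #|B| = count (e N) (iota 0 N).
  by rewrite cardsE -sum1_card -sum1_count -[in iota _ _](subn0 N) big_mkord.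
pose proper := proper_colouring (G := initial_graph N) (C := 'I_q).
transitivity (\sum_(k : {ffun 'I_N -> 'I_q} | proper k) \sum_(c | c \notin k @: B) 1).
  rewrite pair_big_dep sum1_card; apply: eq_card => -[k c].
  by rewrite !inE proper_extend.
transitivity (\sum_(k : {ffun 'I_N -> 'I_q} | proper k)
    (q - count (e N) (iota 0 N))); last first.
  by rewrite sum_nat_const; congr (_ * _); apply: eq_card => k; rewrite inE.
apply: eq_bigr => k /forallP kP.
rewrite sum1_card -[in RHS](card_ord q) -(cardC (mem (k @: B))).
rewrite card_in_imset ?cardB ?addKn // => u v; rewrite !inE => Nu Nv kuv.
apply: val_inj => /=; case: (ltngtP u v) => // uv.
  have /forallP/(_ v) := kP u.
  by rewrite /= (cl N u v) // kuv eqxx.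
have /forallP/(_ u) := kP v.
by rewrite /= (cl N v u) // kuv eqxx.
Qed.

End EliminationOrder.

(** Only the values q beyond all entries of s and t are used: there the truncated
differences are genuine ones, and two polynomials that agree at infinitely many
points are equal.  The roots are read in the field of rationals, where the
factorisation into linear factors is unique. *)
Lemma perm_eq_roots (s t : seq nat) :
  (forall q, \prod_(c <- s) (q - c) = \prod_(c <- t) (q - c)) -> perm_eq s t.
Proof.
move=> st; pose P (r : seq nat) : {poly rat} :=
  (\prod_(c <- [seq (c%:R : rat) | c <- r]) ('X - c%:P))%R.
have natI : injective (fun c : nat => c%:R%R : rat) by exact: mulrIn (oner_neq0 _).
apply: (perm_map_inj natI); apply: prod_XsubC_eq; rewrite -/(P s) -/(P t).
pose b := \max_(c <- s ++ t) c.
have PE r q : {subset r <= s ++ t} -> b <= q ->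
    (P r).[q%:R]%R = (\prod_(c <- r) (q - c))%:R%R.
  move=> rst bq; rewrite /P big_map horner_prod natr_prod.
  apply: eq_big_seq => c /rst cst; rewrite hornerXsubC natrB //.
  by apply: leq_trans bq; apply: leq_bigmax_seq.
apply/subr0_eq; set d := (P s - P t)%R.
apply: (@roots_geq_poly_eq0 _ _ [seq (c%:R : rat)%R | c <- iota b (size d)]).
- apply/allP=> _ /mapP[q + ->]; rewrite mem_iota => /andP[bq _].
  rewrite rootE hornerD hornerN !PE ?st ?subrr // => c.
    by rewrite mem_cat orbC => ->.
  by rewrite mem_cat => ->.
- by rewrite map_inj_uniq ?iota_uniq.
- by rewrite size_map size_iota.
Qed.

(** The adjacency of the dumbbell graph whose right-hand clique starts at the
vertex s = m + l; being a relation on all of nat, it avoids both the integer l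
and the dependency of the vertex type on m, l and n. *)
Definition row_adj (m s : nat) : rel nat := fun i j =>
  (i != j) &&
  [|| (i < m) && (j < m), (s <= i) && (s <= j), j == i.+1 | i == j.+1].

Lemma row_adj_sym m s : symmetric (row_adj m s).
Proof. by move=> i j; rewrite /row_adj; lia. Qed.

Lemma row_adj_irrefl m s : irreflexive (row_adj m s).
Proof. by move=> i; rewrite /row_adj eqxx. Qed.

Definition earlier_degree m s i := if i < m then i else maxn 1 (i - s).

Lemma count_earlier m s i : 0 < m ->
  count (row_adj m s i) (iota 0 i) = earlier_degree m s i.
Proof.
move=> m0.
have count_ge b k : count (leq b) (iota 0 k) = k - b.
  elim: k => [|k IH]; first by rewrite sub0n.
  by rewrite -addn1 iotaD count_cat IH /=; lia.
(* The earlier neighbours of i are consecutive, from b up to i - 1. *)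
pose b := if i < m then 0 else minn i.-1 s.
rewrite (@eq_in_count _ _ (leq b)).
  by rewrite count_ge /b /earlier_degree; case: (ltnP i m); lia.
by move=> j; rewrite mem_iota /row_adj /b; case: (ltnP i m); lia.
Qed.

(** Here p stands for l + 1, which is a natural number also when l = -1. *)
Definition dumbbell_roots m p n := iota 0 m ++ nseq p 1 ++ iota 1 n.-1.

Lemma map_earlier_degree m p n : 0 < m -> 0 < n ->
  [seq earlier_degree m (m + p).-1 i | i <- iota 0 ((m + p).-1 + n)] =
  dumbbell_roots m p n.
Proof.
move=> m0 n0; have -> : (m + p).-1 + n = m + (p + n.-1) by lia.
rewrite !iotaD add0n !map_cat; congr (_ ++ (_ ++ _)).
- by apply: map_id_in => i; rewrite mem_iota /earlier_degree /= add0n => ->.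
- rewrite -[in RHS](size_iota m p) -(size_map (earlier_degree m (m + p).-1)).
  apply/all_pred1P/allP => _ /mapP[i + ->]; rewrite mem_iota /earlier_degree /=.
  by case: (ltnP _ m); lia.
have -> : m + p = (m + p).-1 + 1 by lia.
rewrite iotaDl -map_comp; apply: map_id_in => i.
by rewrite mem_iota /earlier_degree /=; case: (ltnP _ m); lia.
Qed.

Lemma chromatic_count_dumbbell m p n q : 0 < m -> 0 < n ->
  chromatic_count (complete_dumbbell m (p%:Z - 1) n) q =
  \prod_(c <- dumbbell_roots m p n) (q - c).
Proof.
move=> m0 n0; set s := (m + p).-1.
have sE : (m%:Z + (p%:Z - 1) = s%:Z)%R by rewrite /s; lia.
pose G := initial_graph (row_adj_sym m s) (row_adj_irrefl m s).
transitivity (chromatic_count (G (absz (m%:Z + (p%:Z - 1) + n%:Z)%R)) q).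
  apply: eq_card => k; rewrite !inE.
  apply: eq_forallb => u; apply: eq_forallb => v.
  have sle (j : nat) : (m%:Z + (p%:Z - 1) <= j%:Z)%R = (s <= j).
    by rewrite sE lez_nat.
  by rewrite /= /dumbbell_adj /row_adj !sle.
have -> : absz (m%:Z + (p%:Z - 1) + n%:Z)%R = s + n by rewrite sE.
rewrite chromatic_count_elimination.
  rewrite -(big_mkord xpredT (fun i => q - count (row_adj m s i) (iota 0 i))).
  rewrite -(map_earlier_degree p m0 n0) big_map /index_iota subn0.
  by apply: eq_bigr => i _; rewrite count_earlier.
by move=> i j k iN jk ki; rewrite /row_adj /s; lia.
Qed.

Lemma count_dumbbell_roots m p n k : 1 < k ->
  count_mem k (dumbbell_roots m p n) = (k < m) + (k < n).
Proof.
move=> k1; rewrite !count_cat count_nseq !count_uniq_mem ?iota_uniq //.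
by rewrite !mem_iota /=; lia.
Qed.

(** The larger of m and n is the least k >= 2 of multiplicity 0, the smaller one
is the least k >= 2 of multiplicity at most 1; p follows from the number of
roots. *)
Lemma dumbbell_parameters m p n m' p' n' :
  2 < m -> 2 < n -> 2 < m' -> 2 < n' ->
  perm_eq (dumbbell_roots m p n) (dumbbell_roots m' p' n') ->
  p = p' /\ ((m = m' /\ n = n') \/ (m = n' /\ n = m')).
Proof.
move=> m3 n3 m3' n3' E.
have E' k : 1 < k -> (k < m) + (k < n) = (k < m') + (k < n').
  move=> k1; rewrite -(count_dumbbell_roots m p n k1).
  by rewrite -(count_dumbbell_roots m' p' n' k1); apply/permP.
have := perm_size E; rewrite !size_cat !size_iota !size_nseq.
(* The multiplicities at the four parameters themselves suffice. *)
have := E' m; have := E' n; have := E' m'; have := E' n'.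
lia.
Qed.

Lemma isomorphic_flip m n (l : int) : (-1 <= l)%R -> 0 < m -> 0 < n ->
  isomorphic (complete_dumbbell m l n) (complete_dumbbell n l m).
Proof.
move=> l1 m0 n0.
have NE : absz (m%:Z + l + n%:Z)%R = absz (n%:Z + l + m%:Z)%R by lia.
exists (fun i => cast_ord NE (rev_ord i)); split.
  exists (fun i => rev_ord (cast_ord (esym NE) i)) => i.
    by rewrite cast_ordK rev_ordK.
  by rewrite rev_ordK cast_ordKV.
move=> u v; rewrite /= /dumbbell_adj -!val_eqE /=.
have := ltn_ord u; have := ltn_ord v.
move: (nat_of_ord u) (nat_of_ord v) => {}u {}v; lia.
Qed.

Local Open Scope ring_scope.

Theorem theorem4p8 (m n m' n' : nat) (l l' : int)
    (hm : (3 <= m)%N) (hn : (3 <= n)%N) (hm' : (3 <= m')%N) (hn' : (3 <= n')%N)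
    (hl : -1 <= l) (hl' : -1 <= l') :
  ~ isomorphic (complete_dumbbell m l n) (complete_dumbbell m' l' n') ->
  chromatic_symmetric_function (complete_dumbbell m l n)
    <> chromatic_symmetric_function (complete_dumbbell m' l' n').
Proof.
move=> niso XE; apply: niso.
have [p lE] : exists p : nat, l = p%:Z - 1 by exists (absz (l + 1)); lia.
have [p' lE'] : exists p : nat, l' = p%:Z - 1 by exists (absz (l' + 1)); lia.
have roots_eq : perm_eq (dumbbell_roots m p n) (dumbbell_roots m' p' n').
  apply: perm_eq_roots => q; rewrite -!chromatic_count_dumbbell; try lia.
  by rewrite -lE -lE'; apply: chromatic_count_determined.
have [pE mnE] := dumbbell_parameters hm hn hm' hn' roots_eq.
have {lE'} <- : l = l' by rewrite lE lE' pE.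
case: mnE => -[<- <-]; first by exists id; split=> //; exists id.
by apply: isomorphic_flip => //; lia.
Qed.
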